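(* Let $\mathcal M=(Q,A,\tau,\sigma)$ be a cyclic Mealy automaton with $|A|$ prime, and let $\Gamma=\Gamma_{\mathcal M,\infty}$. Suppose there is a letter $x\in A$ and constants $\alpha>0$, $K>1$ such that, for all sufficiently large $r$, $$|B_\Gamma(xxx\dots,r)|\ge K^{r^\alpha}.$$ Then there is a constant $C>0$ such that for all $n$, $$\operatorname{diam}(\Gamma_{\mathcal M,n})\le C\,n^{1+1/\alpha}.$$
   Context: A Mealy automaton $\mathcal M=(Q,A,\tau,\sigma)$ consists of finite sets $Q$ (states) and $A$ (alphabet) and functions $\sigma:Q\times A\to A$ (output) and $\tau:Q\times A\to Q$ (transition); write $\sigma_q(x)=\sigma(q,x)$. For $q\in Q$, the length-preserving map $\boldsymbol\sigma_q$ on finite and infinite words over $A$ is defined recursively by $\boldsymbol\sigma_q(x_0x_1x_2\dots)=y_0\,\boldsymbol\sigma_r(x_1x_2\dots)$, where $y_0=\sigma(q,x_0)$ and $r=\tau(q,x_0)$ (and the empty word is fixed). $\mathcal M$ is invertible if $\sigma_q:A\to A$ is a bijection for every $q\in Q$. $\mathcal M$ is cyclic if it is invertible and the permutation group $\langle\sigma_q\mid q\in Q\rangle$ of $A$ equals $\langle (x_1\,x_2\,\dots\,x_k)\rangle$ for some enumeration $A=\{x_1,\dots,x_k\}$, $k=|A|$ (i.e. it is generated by a $k$-cycle). For $n\in\{1,2,\dots\}\cup\{\infty\}$, the Schreier graph $\Gamma_{\mathcal M,n}$ of an invertible automaton is the directed graph (self-loops and repeated edges allowed) with vertex set $A^n$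 (words of length $n$; infinite words $x_0x_1x_2\dots$ if $n=\infty$) and one edge $s\to\boldsymbol\sigma_q(s)$ for each vertex $s$ and each $q\in Q$. In a graph $\Gamma$, $d_\Gamma(v,w)$ is the length of a shortest undirected path between $v$ and $w$ ($\infty$ if none exists), $B_\Gamma(v,r)=\{w: d_\Gamma(v,w)\le r\}$ for a nonnegative integer $r$, and $\operatorname{diam}(\Gamma)=\max_{v,w}d_\Gamma(v,w)$. *)

(* Defs.v *)
From mathcomp Require Import all_boot all_order all_algebra all_fingroup.
From mathcomp Require Import all_classical all_reals all_analysis.

Set Implicit Arguments.
Unset Strict Implicit.
Unset Printing Implicit Defensive.

Import Order.TTheory GRing.Theory Num.Theory.

Local Open Scope classical_set_scope.
Local Open Scope ring_scope.

Record mealy (Q A : finType) := Mealy {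
  trans : Q -> A -> Q;
  out : Q -> A -> A
}.

Section MealyAction.
Variables (Q A : finType) (M : mealy Q A).

Fixpoint act_seq (q : Q) (s : seq A) : seq A :=
  if s is x :: s' then out M q x :: act_seq (trans M q x) s' else [::].

Lemma size_act_seq (q : Q) (s : seq A) : size (act_seq q s) = size s.
Proof. by elim: s q => //= x s IHs q; rewrite IHs. Qed.

Lemma act_tuple_proof (n : nat) (q : Q) (s : n.-tuple A) :
  size (act_seq q s) == n.
Proof. by rewrite size_act_seq size_tuple. Qed.

Definition act_tuple (n : nat) (q : Q) (s : n.-tuple A) : n.-tuple A :=
  Tuple (act_tuple_proof q s).

Fixpoint act_stream_rec (i : nat) (q : Q) (s : nat -> A) : A :=
  if i is j.+1 then act_stream_rec j (trans M q (s 0%N)) (fun k => s k.+1)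
  else out M q (s 0%N).

Definition act_stream (q : Q) (s : nat -> A) : nat -> A :=
  fun i => act_stream_rec i q s.

Definition invertible_mealy : Prop := forall q : Q, bijective (out M q).

Definition out_perm (invM : invertible_mealy) (q : Q) : {perm A} :=
  perm (bij_inj (invM q)).

(* [c =1 next s] says that [c] is the cycle (x_1 x_2 ... x_k), where
   [s = [:: x_1; x_2; ...; x_k]]. *)
Definition full_cycle (c : {perm A}) : Prop :=
  exists s : seq A, [/\ uniq s, forall x : A, x \in s & c =1 next s].

Definition cyclic_mealy : Prop :=
  exists invM : invertible_mealy, exists2 c : {perm A}, full_cycle c &
    (<<[set out_perm invM q | q : Q]>> = <[c]>)%g.

End MealyAction.

Record digraph (V E : Type) := Digraph {
  source : E -> V;
  target : E -> V
}.

Section GraphDistance.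
Variables (R : realType) (V E : Type) (G : digraph V E).

Definition adjacent (v w : V) : Prop :=
  exists e : E, (source G e = v /\ target G e = w) \/
                (source G e = w /\ target G e = v).

Definition upath_of_length (v w : V) (n : nat) : Prop :=
  exists p : seq V, [/\ path (fun a b => `[< adjacent a b >]) v p,
                        last v p = w & size p = n].

(* The infimum of the empty set is [+oo]. *)
Definition gdist (v w : V) : \bar R :=
  ereal_inf [set n%:R%:E | n in upath_of_length v w].

Definition gball (v : V) (r : nat) : set V :=
  [set w | (gdist v w <= r%:R%:E)%E].

Definition diam : \bar R :=
  ereal_sup [set gdist vw.1 vw.2 | vw in [set: V * V]].

End GraphDistance.

Section Schreier.
Variables (Q A : finType) (M : mealy Q A).

Definition schreier (n : nat) : digraph (n.-tuple A) (n.-tuple A * Q) :=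
  Digraph (fun e => e.1) (fun e => act_tuple M e.2 e.1).

Definition schreier_infty : digraph (nat -> A) ((nat -> A) * Q) :=
  Digraph (fun e => e.1) (fun e => act_stream M e.2 e.1).

End Schreier.

(* Main.v *)
Require Import Defs.
From mathcomp Require Import all_boot all_order all_algebra all_fingroup.
From mathcomp Require Import all_classical all_reals all_analysis.
From mathcomp Require Import cyclic ring.

Set Implicit Arguments.
Unset Strict Implicit.
Unset Printing Implicit Defensive.

Import Order.TTheory GRing.Theory Num.Theory.

Local Open Scope classical_set_scope.
Local Open Scope ring_scope.

(** Identify A with Z/p, p = |A|, so that every state permutes A by a
translation.  Write X_n for the word x...x of length n, and say that level n
is shaken within distance d ([fibre_move]) when some path of length at most d
in the Schreier graph of level n + 1 leads from X_n x to X_n z with z <> x.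

- A deeper level is no easier to shake
  ([fibre_move_le]): deleting the first letter of every word is a morphism of
  Schreier graphs, because a state acts on the tail of a word as another
  state.

- If the ball of radius r about xxx... has more than p ^ n points, then two of
  its points share their first n letters.  Let k >= n be the first position at
  which they differ, and truncate to k + 1 letters the paths from xxx... to
  the two points.  Following one of them and coming back along the other, transported
  to the letter just reached, ends at X_k z with z <> x; so level k, hence level
  n, is shaken within 2 r ([fibre_move_of_large_ball]).

- A path at level n carries the whole fibre of letters over its start to the
  fibre over its end by one power of the p-cycle ([upath_rcons]).  If level n is
  shaken within d, the loop at X_n therefore acts on its fibre by a nontrivial
  element of a group of prime order p that acts transitively; repeating it
  fewer than p times joins any two words X_n y and X_n z
  ([fibre_move_transitive]).

- Correcting one letter at a time, every word of length n reaches X_n within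
  n p d steps ([upath_to_nseq]), so the diameter is at most 2 n p d.

Growth at least K ^ (r ^ alpha) makes the ball larger than p ^ n as soon as
r exceeds (n ln p / ln K) ^ (1 / alpha), so d is of the order of
n ^ (1 / alpha) ([large_ball_radius]), and the bound n ^ (1 + 1 / alpha)
follows. *)

(* The bare name would denote adjacent real sequences. *)
Local Notation adjacent := Defs.adjacent.

(** * Undirected paths and distance *)

Section UndirectedPaths.
Variables (V E : Type) (G : digraph V E).

Lemma adjacent_sym v w : adjacent G v w -> adjacent G w v.
Proof. by case=> e [h|h]; exists e; [right|left]. Qed.

Lemma upath0 v : upath_of_length G v v 0.
Proof. by exists [::]; split. Qed.

Lemma upath0_eq v w : upath_of_length G v w 0 -> v = w.
Proof. by case=> -[|a p] []. Qed.

Lemma upathSP v w n :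
  upath_of_length G v w n.+1 <->
  exists2 u, adjacent G v u & upath_of_length G u w n.
Proof.
split=> [[[|u p] []//= /andP[/asboolP vu up] pw [sp]]|[u vu [p [up pw sp]]]].
  by exists u => //; exists p.
by exists (u :: p); split=> //=; [rewrite up andbT; apply/asboolP | rewrite sp].
Qed.

Lemma upath_cat u v w m n : upath_of_length G u v m ->
  upath_of_length G v w n -> upath_of_length G u w (m + n).
Proof.
elim: m u => [|m IHm] u; first by move=> /upath0_eq ->.
by move=> /upathSP[t ut tv] vw; apply/upathSP; exists t => //; exact: IHm.
Qed.

Lemma upath_sym u v m : upath_of_length G u v m -> upath_of_length G v u m.
Proof.
elim: m u => [|m IHm] u; first by move=> /upath0_eq ->; exact: upath0.
move=> /upathSP[t ut /IHm vt]; rewrite -addn1; apply: (upath_cat vt).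
by apply/upathSP; exists u; [exact: adjacent_sym | exact: upath0].
Qed.

(** A finite infimum of path lengths is attained, as they are naturals. *)
Lemma gdist_le (R : realType) v w r :
  (gdist R G v w <= r%:R%:E)%E <->
  exists2 m, (m <= r)%N & upath_of_length G v w m.
Proof.
split=> [vwr|[m mr vw]]; last first.
  by apply: ge_ereal_inf; exists m%:R%:E; [exists m | rewrite lee_fin ler_nat].
have /ereal_inf_lt[_ [m vw <-]] : (gdist R G v w < r.+1%:R%:E)%E.
  by apply: le_lt_trans vwr _; rewrite lte_fin ltr_nat.
by rewrite lte_fin ltr_nat ltnS; exists m.
Qed.

End UndirectedPaths.

Lemma upath_morph (V E V' E' : Type) (G : digraph V E) (G' : digraph V' E')
    (f : V -> V') :
  (forall v w, adjacent G v w -> adjacent G' (f v) (f w)) ->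
  forall v w m, upath_of_length G v w m -> upath_of_length G' (f v) (f w) m.
Proof.
move=> fadj v w m; elim: m v => [|m IHm] v.
  by move=> vw; rewrite (upath0_eq vw); exact: upath0.
move=> /upathSP[t /fadj vt /IHm tw].
by apply/upathSP; exists (f t).
Qed.

(** * Counting and cyclic permutations *)

(** The pigeonhole principle; in particular an infinite [B], whose counting
measure is [+oo], admits no such [f]. *)
Lemma counting_le_card (R : realType) (T : choiceType) (F : finType)
    (f : T -> F) (B : set T) : {in B &, injective f} ->
  (counting B <= #|F|%:R%:E :> \bar R)%E.
Proof.
move=> injf; have finB : finite_set B.
  rewrite -(eq_finite_set (inj_card_eq injf)); exact: finite_finset.
rewrite /counting asboolT// lee_fin ler_nat -(size_map f).
rewrite -[X in (X <= _)%N](card_uniqP _) ?max_card//.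
rewrite map_inj_in_uniq ?finmap.fset_uniq// => s t.
by rewrite !in_fset_set//; exact: injf.
Qed.

Lemma full_cycle_order (A : finType) (c : {perm A}) :
  prime #|A| -> full_cycle c -> #[c]%g = #|A|.
Proof.
move=> primeA [s [us sA cs]].
have nextc : next s =1 c by move=> y.
have cyc : fcycle c s by rewrite -(eq_fcycle nextc); exact: cycle_next.
have sizes : size s = #|A|.
  by rewrite -(card_uniqP us); apply: eq_card => y; rewrite sA.
have : (#[c]%g %| #|A|)%N.
  rewrite order_dvdn; apply/eqP/permP => y; rewrite permX perm1 -sizes.
  by rewrite -(order_cycle cyc us (sA y)) (iter_order_cycle cyc).
case/primeP: (primeA) => A1 /[apply] /orP[|/eqP//].
rewrite order_eq1 => /eqP c1; suff : (#|A| <= 1)%N by rewrite leqNgt A1.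
apply/card_le1_eqP => y z _ _.
have /iter_findex <- : fconnect c y z by rewrite (fconnect_cycle cyc).
by rewrite c1; elim: findex => //= i ->; rewrite perm1.
Qed.

(** A nontrivial element of a group of prime order generates it, and the group
generated by a full cycle is transitive. *)
Lemma prime_cycle_transitive (A : finType) (c g : {perm A}) (y z : A) :
  prime #|A| -> #[c]%g = #|A| -> (g \in <[c]>)%g -> g != 1%g ->
  exists2 i, (i < #|A|)%N & (g ^+ i)%g y = z.
Proof.
move=> primeA oc gc g1.
have og : #[g]%g = #|A|.
  have := order_dvdG gc; rewrite -orderE oc.
  case/primeP: primeA => _ /[apply] /orP[|/eqP//].
  by rewrite order_eq1 (negbTE g1).
have : z \in orbit 'P <[g]> y by rewrite perm_prime_orbit.
by case/orbitP => _ /cyclePmin[i ig ->] <-; exists i; rewrite -?og.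
Qed.

(** * Schreier graphs of successive levels *)

Section SchreierGraphs.
Variables (Q A : finType) (M : mealy Q A).

Lemma adjacent_schreierP n (u v : n.-tuple A) :
  adjacent (schreier M n) u v <->
  exists q, act_tuple M q u = v \/ act_tuple M q v = u.
Proof.
split=> [[[s q] /= [[<- sw]|[<- sw]]]|[q [uv|vu]]].
- by exists q; left.
- by exists q; right.
- by exists (u, q); left.
- by exists (v, q); right.
Qed.

(** Self-similarity: after reading the first letter, a state acts on the rest of
the word as another state, so deleting first letters preserves edges. *)
Lemma upath_behead n (u v : n.+1.-tuple A) m :
  upath_of_length (schreier M n.+1) u v m ->
  upath_of_length (schreier M n) (behead_tuple u) (behead_tuple v) m.
Proof.
apply: upath_morph => {}u {}v /adjacent_schreierP[q uv].
case/tupleP: u uv => a u; case/tupleP: v => b v uv.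
apply/adjacent_schreierP; case: uv => /(congr1 val) [_ uv].
  by exists (trans M q a); left; exact: val_inj.
by exists (trans M q b); right; exact: val_inj.
Qed.

Definition prefix_tuple n (s : nat -> A) : n.-tuple A := [tuple of mkseq s n].

Lemma act_prefix n q s :
  act_tuple M q (prefix_tuple n s) = prefix_tuple n (act_stream M q s).
Proof.
apply: val_inj => /=; elim: n q s => // n IHn q s.
have mkseqSl (t : nat -> A) : mkseq t n.+1 = t 0%N :: mkseq (t \o succn) n.
  by rewrite /mkseq /= (iotaDl 1 0) -map_comp.
by rewrite !mkseqSl /= IHn.
Qed.

Lemma upath_prefix n s t m :
  upath_of_length (schreier_infty M) s t m ->
  upath_of_length (schreier M n) (prefix_tuple n s) (prefix_tuple n t) m.
Proof.
apply: upath_morph => {}s {}t [[u q] /= st]; apply/adjacent_schreierP.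
by exists q; rewrite !act_prefix; case: st => -[<- <-]; [left|right].
Qed.

Lemma prefix_tupleS n s :
  prefix_tuple n.+1 s = rcons_tuple (prefix_tuple n s) (s n).
Proof. by apply: val_inj; rewrite /= mkseqS. Qed.

Lemma prefix_tuple_cst n x : prefix_tuple n (fun=> x) = nseq_tuple n x.
Proof.
apply: val_inj; apply: (@eq_from_nth _ x); rewrite size_mkseq ?size_nseq// => i.
by move=> ilt; rewrite nth_mkseq// nth_nseq ilt.
Qed.

Lemma tuple_rconsP n (t : n.+1.-tuple A) :
  exists u : n.-tuple A, exists z, t = rcons_tuple u z.
Proof.
case: t => [[//|a s] /= sz].
have szb : size (belast a s) == n by rewrite size_belast.
by exists (Tuple szb), (last a s); apply: val_inj; rewrite /= lastI.
Qed.

Lemma rcons_tuple_inj n (u v : n.-tuple A) y z :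
  rcons_tuple u y = rcons_tuple v z -> u = v /\ y = z.
Proof. by move=> /(congr1 val) /= /rcons_inj[/val_inj-> ->]. Qed.

Lemma act_rcons n q (u : n.-tuple A) z :
  act_tuple M q (rcons_tuple u z) =
  rcons_tuple (act_tuple M q u) (out M (foldl (trans M) q u) z).
Proof.
apply: val_inj => /=; move: (tval u) => s {u}.
by elim: s q => //= a s IHs q; rewrite IHs.
Qed.

(** * Transport of the last letter along paths *)

Section Fibres.
Variable c : {perm A}.
Hypothesis out_c : forall q, exists2 h, (h \in <[c]>)%g & out M q =1 h.

(** What an edge does to the last letter depends only on the state reached after
reading the other letters, so it is the same permutation on the whole fibre. *)
Lemma adjacent_rcons n (u v : n.-tuple A) y z :
  adjacent (schreier M n.+1) (rcons_tuple u y) (rcons_tuple v z) ->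
  exists g, [/\ (g \in <[c]>)%g, g y = z & forall t,
    adjacent (schreier M n.+1) (rcons_tuple u t) (rcons_tuple v (g t))].
Proof.
move=> /adjacent_schreierP[q]; rewrite !act_rcons.
case=> /rcons_tuple_inj [<- <-].
  have [h hc outh] := out_c (foldl (trans M) q u).
  exists h; split=> // t; apply/adjacent_schreierP.
  by exists q; left; rewrite act_rcons outh.
have [h hc outh] := out_c (foldl (trans M) q v).
exists h^-1%g; split=> [||t]; first by rewrite groupV.
  by rewrite outh permK.
by apply/adjacent_schreierP; exists q; right; rewrite act_rcons outh permKV.
Qed.

(** The holonomy of a path: the permutations met along its edges compose. *)
Lemma upath_rcons n (u v : n.-tuple A) y z m :
  upath_of_length (schreier M n.+1) (rcons_tuple u y) (rcons_tuple v z) m ->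
  exists g, [/\ (g \in <[c]>)%g, g y = z & forall t,
    upath_of_length (schreier M n.+1)
      (rcons_tuple u t) (rcons_tuple v (g t)) m].
Proof.
elim: m u y => [|m IHm] u y.
  move=> uv; have [-> ->] := rcons_tuple_inj (upath0_eq uv).
  by exists 1%g; split=> [||t]; rewrite ?perm1//; exact: upath0.
move=> /upathSP[w]; have [w' [a ->]] := tuple_rconsP w.
move=> /adjacent_rcons[g [gc <- gadj]] /IHm[h [hc <- hpath]].
exists (g * h)%g; split=> [||t]; rewrite ?groupM ?permM//.
by apply/upathSP; exists (rcons_tuple w' (g t)).
Qed.

(** Forgetting the last letter is a covering of Schreier graphs. *)
Lemma upath_lift n (u v : n.-tuple A) y m :
  upath_of_length (schreier M n) u v m -> exists z,
  upath_of_length (schreier M n.+1) (rcons_tuple u y) (rcons_tuple v z) m.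
Proof.
elim: m u y => [|m IHm] u y.
  by move=> uv; rewrite (upath0_eq uv); exists y; exact: upath0.
move=> /upathSP[w /adjacent_schreierP[q uw] wv].
have [a uwa] : exists a,
    adjacent (schreier M n.+1) (rcons_tuple u y) (rcons_tuple w a).
  case: uw => <-.
    exists (out M (foldl (trans M) q u) y); apply/adjacent_schreierP.
    by exists q; left; rewrite act_rcons.
  have [h _ outh] := out_c (foldl (trans M) q w).
  exists (h^-1%g y); apply/adjacent_schreierP.
  by exists q; right; rewrite act_rcons outh permKV.
have [z az] := IHm w a wv.
by exists z; apply/upathSP; exists (rcons_tuple w a).
Qed.

(** * Moving one letter after a constant word *)

Variable x : A.

Definition fibre_move n d := exists z m, [/\ z != x, (m <= d)%N &
  upath_of_length (schreier M n.+1)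
    (rcons_tuple (nseq_tuple n x) x) (rcons_tuple (nseq_tuple n x) z) m].

(** Deleting the first letter sends [x...x z] of one level to that of the
previous level without touching the last letter. *)
Lemma fibre_move_le k n d : (k <= n)%N -> fibre_move n d -> fibre_move k d.
Proof.
move=> /subnK <-; elim: (n - k)%N => // i IHi [z [m [zx md xz]]].
apply: IHi; exists z, m; split=> //.
have beheadE a : behead_tuple (rcons_tuple (nseq_tuple (i.+1 + k) x) a) =
    rcons_tuple (nseq_tuple (i + k) x) a :> (i + k).+1.-tuple A.
  exact: val_inj.
by have := upath_behead xz; rewrite !beheadE.
Qed.

(** In terms of group elements: if [a] and [b] move [xxx...] to two points with
the same first [n] letters, then the quotient of [a] by [b] fixes the first [n]
letters of [xxx...] but not all of it.  Its first moved letter may lie far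
beyond position [n], which is why deletion of first letters is needed. *)
Lemma fibre_move_of_large_ball (R : realType) n r :
  ((#|A| ^ n)%N%:R%:E <
     counting (gball R (schreier_infty M) (fun=> x) r) :> \bar R)%E ->
  fibre_move n (r + r).
Proof.
set B := gball _ _ _ _ => cardB.
have [s [t [Bs Bt st_n /eqP st]]] : exists s t,
    [/\ B s, B t, prefix_tuple n s = prefix_tuple n t & s != t].
  apply: contrapT => noncoll; move: cardB; rewrite ltNge => /negP; apply.
  rewrite -card_tuple; apply: (@counting_le_card _ _ _ (prefix_tuple n)).
  move=> s t /set_mem Bs /set_mem Bt st; apply: contrapT => /eqP nst.
  by apply: noncoll; exists s, t.
have diff : exists i, s i != t i.
  apply: contrapT => same; apply: st; apply/funext => i; apply/eqP.
  by apply: contrapT => /negP ne; apply: same; exists i.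
have [k stk kmin] := ex_minnP diff.
have st_k : prefix_tuple k s = prefix_tuple k t.
  apply: val_inj; apply/eq_in_map => i; rewrite mem_iota => /andP[_ ik].
  by apply/eqP/negP => /negP /kmin; rewrite leqNgt ik.
have nk : (n <= k)%N.
  rewrite leqNgt; apply/negP => kn; move/eqP: stk; apply.
  by have := congr1 (fun u => nth x (tval u) k) st_n; rewrite !nth_mkseq.
apply: (fibre_move_le nk).
have [m mr xs] := (gdist_le _ _ _ _ _).1 Bs.
have [l lr xt] := (gdist_le _ _ _ _ _).1 Bt.
move: (upath_prefix k.+1 xs) (upath_prefix k.+1 xt).
rewrite !prefix_tupleS prefix_tuple_cst -st_k.
move=> /upath_rcons[g [_ gx gpath]] xtk.
have gt := gpath (g^-1%g (t k)); rewrite permKV in gt.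
(* Follow the path to [t], then the path to [s] backwards; by transport, the
   latter may start at the last letter [t k] instead of [s k], and then it does
   not end at [x]. *)
exists (g^-1%g (t k)), (l + m)%N; split; last first.
- by apply: upath_cat xtk _; exact: upath_sym.
- exact: leq_add.
- by apply: contra stk => /eqP gtk; rewrite -gx -gtk permKV.
Qed.

Hypotheses (primeA : prime #|A|) (order_c : #[c]%g = #|A|).

(** The loop given by [fibre_move] has nontrivial holonomy in a group of prime
order; its iterates join all letters of the fibre. *)
Lemma fibre_move_transitive n d y z : fibre_move n d ->
  exists2 m, (m <= #|A| * d)%N & upath_of_length (schreier M n.+1)
    (rcons_tuple (nseq_tuple n x) y) (rcons_tuple (nseq_tuple n x) z) m.
Proof.
move=> [a [m [ax md /upath_rcons[g [gc gx gpath]]]]].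
have g1 : g != 1%g by apply: contraNneq ax => g1; rewrite -gx g1 perm1.
have [i iA <-] := prime_cycle_transitive y z primeA order_c gc g1.
exists (i * m)%N; first exact: leq_mul (ltnW iA) md.
elim: i {iA} => [|i IHi]; first by rewrite mul0n expg0 perm1; exact: upath0.
by rewrite mulSn addnC expgSr permM; exact: upath_cat IHi (gpath _).
Qed.

(** By induction on the level: lift a path that makes all letters but the last
equal to [x], then correct the last one inside the fibre. *)
Lemma upath_to_nseq n d (u : n.-tuple A) : fibre_move n d ->
  exists2 m, (m <= n * (#|A| * d))%N &
    upath_of_length (schreier M n) u (nseq_tuple n x) m.
Proof.
elim: n u => [|n IHn] u.
  move=> _; exists 0%N; rewrite // (tuple0 u) (tuple0 (nseq_tuple 0 x)).
  exact: upath0.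
move=> /(fibre_move_le (leqnSn n)) mv.
have [v [y ->]] := tuple_rconsP u.
have [m mle /(upath_lift y)[z yz]] := IHn v mv.
have [l lle zx] := fibre_move_transitive z x mv.
have nseqS : nseq_tuple n.+1 x = rcons_tuple (nseq_tuple n x) x.
  by apply: val_inj => /=; elim: (n) => //= i <-.
exists (m + l)%N; first by rewrite mulSn addnC leq_add.
by rewrite nseqS; exact: upath_cat yz zx.
Qed.

Lemma diam_le (R : realType) n d : fibre_move n d ->
  (diam R (schreier M n) <= (2 * (n * (#|A| * d)))%N%:R%:E)%E.
Proof.
move=> mv; apply: ge_ereal_sup => _ [[u v] _ <-].
have [m mle ux] := upath_to_nseq u mv.
have [l lle vx] := upath_to_nseq v mv.
apply/gdist_le; exists (m + l)%N; first by rewrite mul2n -addnn leq_add.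
exact: upath_cat ux (upath_sym vx).
Qed.

End Fibres.
End SchreierGraphs.

(** * The radius at which balls outgrow the words of length n *)

(** The threshold is [(n ln p / ln K) ^ (1 / alpha)]; the lower bound [a] and
the rounding up are absorbed into the constant since [n ^ (1 / alpha) >= 1]. *)
Lemma large_ball_radius (R : realType) (a p : nat) (alpha K : R) :
  0 < alpha -> 1 < K -> (0 < p)%N ->
  exists2 b : R, 0 <= b & forall n, (0 < n)%N -> exists r : nat,
    [/\ (a <= r)%N, r%:R <= b * n%:R `^ alpha^-1 &
        (p ^ n)%:R < K `^ (r%:R `^ alpha)].
Proof.
move=> alpha0 K1 p0.
have lnK : 0 < ln K by rewrite ln_gt0.
have lnp : 0 <= ln (p%:R : R) by rewrite ln_ge0// ler1n.
pose e := ln (p%:R : R) / ln K.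
have e0 : 0 <= e by rewrite divr_ge0// ltW.
exists (a.+1%:R + e `^ alpha^-1); first by rewrite addr_ge0// powR_ge0.
move=> n n0; have n1 : 1 <= n%:R `^ alpha^-1 :> R.
  by rewrite -[leLHS](powRr0 n%:R) ler_powR ?ler1n// invr_ge0 ltW.
pose s := (e * n%:R) `^ alpha^-1.
have s0 : 0 <= s by exact: powR_ge0.
have /andP[ts st] := truncn_itv s0.
exists (a + (Num.truncn s).+1)%N; split; first exact: leq_addr.
  rewrite addnS -addSn natrD mulrDl lerD ?ler_peMr//.
  by apply: le_trans ts _; rewrite /s powRM.
have sr : s < (a + (Num.truncn s).+1)%:R.
  by apply: lt_le_trans st _; rewrite ler_nat leq_addl.
rewrite -ltr_ln ?posrE ?powR_gt0 ?ltr0n ?expn_gt0 ?p0//; last first.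
  exact: lt_trans K1.
rewrite natrX lnXn ?ltr0n// ln_powR -ltr_pdivrMr// -[_ *+ n]mulr_natr mulrAC.
have -> : ln p%:R / ln K * n%:R = s `^ alpha.
  by rewrite /s -powRrM mulVf ?gt_eqF// powRr1// mulr_ge0.
by apply: gt0_ltr_powR; rewrite // nnegrE.
Qed.

(** * The diameter bound *)

Theorem theorem8p1 (R : realType) (Q A : finType) (M : mealy Q A)
    (hM : cyclic_mealy M) (hA : prime #|A|)
    (x : A) (alpha K : R) (halpha : 0 < alpha) (hK : 1 < K)
    (hball : exists r0 : nat, forall r : nat, (r0 <= r)%N ->
      ((K `^ (r%:R `^ alpha))%:E
         <= counting (gball R (schreier_infty M) (fun _ : nat => x) r))%E) :
  exists2 C : R, 0 < C &
    forall n : nat, (0 < n)%N ->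
      (diam R (schreier M n) <= (C * n%:R `^ (1 + alpha^-1))%:E)%E.
Proof.
have [invM [c fc gen_c]] := hM.
have out_c q : exists2 h, (h \in <[c]>)%g & out M q =1 h.
  exists (Defs.out_perm invM q); last by move=> y; rewrite permE.
  by rewrite -gen_c; apply/mem_gen/imset_f.
have [r0 r0P] := hball.
have [b b0 bP] := large_ball_radius r0 halpha hK (prime_gt0 hA).
(* The diameter is at most [2 * n * p * d] with [d = 2 * r]; adding 1 makes the
   constant positive even when [b = 0]. *)
exists (4%:R * #|A|%:R * b + 1) => [|n n0].
  by rewrite ltr_wpDl// !mulr_ge0.
have [r [r0r rle rlt]] := bP n n0.
have mv : fibre_move M x n (r + r).
  apply: (@fibre_move_of_large_ball _ _ _ _ out_c _ R).
  by apply: lt_le_trans (r0P r r0r); rewrite lte_fin.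
apply: le_trans (diam_le out_c hA (full_cycle_order hA fc) R mv) _.
rewrite lee_fin powRD; last by rewrite pnatr_eq0 -lt0n n0 implybT.
rewrite powRr1//.
have -> : (2 * (n * (#|A| * (r + r))))%N%:R =
    4%:R * #|A|%:R * n%:R * r%:R :> R by rewrite !natrM natrD; ring.
apply: (@le_trans _ _ (4%:R * #|A|%:R * n%:R * (b * n%:R `^ alpha^-1))).
  by rewrite ler_wpM2l ?mulr_ge0.
set t := n%:R `^ alpha^-1.
have -> : (4%:R * #|A|%:R * b + 1) * (n%:R * t) =
    4%:R * #|A|%:R * n%:R * (b * t) + n%:R * t by ring.
by rewrite lerDl mulr_ge0 ?powR_ge0.
Qed.
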